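(* Let $C_1,\dots,C_{n+2}$ be $n+2$ distinct $(n-1)$-spheres in $\mathbb{R}^n$. Let $A=[\mathbf{C}_1\mid\dots\mid\mathbf{C}_{n+2}]$ be the $(n+2)\times(n+2)$ matrix whose columns are their Pedoe vectors, and define the configuration matrix of this system of spheres to be $f=A^{T}gA$. If $f$ is invertible, then $$A\,F\,A^{T}=G,$$ where $F=f^{-1}$ and $G=g^{-1}$. In particular, the curvatures and positions of $n+1$ spheres determine the remaining sphere(s) of the configuration by the quadratic relation $$\mathbf v_i^{T}F\,\mathbf v_j=G_{ij},$$ where the $n+2$ vectors $\mathbf v_i$, $i=1,\dots,n+2$, are defined as follows: $\mathbf v_1=\mathbf b=[b_1,\dots,b_{n+2}]^T$, where $b_i=1/r_i$ is the curvature of the $i$-th sphere; $\mathbf v_2=\bar{\mathbf b}=[\bar b_1,\dots,\bar b_{n+2}]^T$, where $\bar b_i$ is the co-curvature of the $i$-th sphere; and $\mathbf v_{2+k}=\dot{\mathbf x}_k=[\dot x_{k1},\dots,\dot x_{k,n+2}]^T$ for $k=1,\dots,n$, where $\dot x_{ki}=x_{ki}/r_i$, $r_i$ is the radius of the $i$-th sphere and $x_{ki}$ is the $k$-th coordinate of its center.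
   Context: On $\mathbb{R}^{n+2}$ let $g$ be the block-diagonal symmetric matrix (Minkowski metric) $$g=\begin{bmatrix}0&\tfrac12\\ \tfrac12&0\end{bmatrix}\oplus(-I_n),\qquad G=g^{-1}=\begin{bmatrix}0&2\\2&0\end{bmatrix}\oplus(-I_n).$$ The Pedoe vector of the $(n-1)$-sphere $\{\mathbf x\in\mathbb{R}^n: |\mathbf x-\mathbf p|^2=r^2\}$ with center $\mathbf p=(p_1,\dots,p_n)\in\mathbb{R}^n$ and radius $r>0$ is $$\mathbf{C}=\left[\tfrac1r,\ \tfrac{|\mathbf p|^2-r^2}{r},\ \tfrac{p_1}{r},\dots,\tfrac{p_n}{r}\right]^T\in\mathbb{R}^{n+2}.$$ It satisfies $\mathbf C^Tg\,\mathbf C=-1$. Its first entry $b=1/r$ is the curvature and its second entry $\bar b=(|\mathbf p|^2-r^2)/r$ is the co-curvature of the sphere. *)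

(* Defs.v *)
From HB Require Import structures.
From mathcomp Require Import all_boot all_order all_algebra.
From mathcomp Require Import reals.

Set Implicit Arguments.
Unset Strict Implicit.
Unset Printing Implicit Defensive.

Import Order.TTheory GRing.Theory Num.Theory.
Local Open Scope ring_scope.

(* Squared Euclidean norm. *)
Definition sqnorm (R : realType) (n : nat) (p : 'cV[R]_n) : R :=
  \sum_(k < n) p k 0 ^+ 2.

(* The sphere {x | sqnorm (x - center) = radius ^+ 2}.  For n >= 1 such a point
   set has a unique center and a unique positive radius, so distinct spheres
   are distinct elements of this type. *)
Record sphere (R : realType) (n : nat) := Sphere {
  center : 'cV[R]_n;
  radius : R;
  radius_gt0 : 0 < radius }.

Definition curvature (R : realType) (n : nat) (S : sphere R n) : R :=
  1 / radius S.

Definition cocurvature (R : realType) (n : nat) (S : sphere R n) : R :=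
  (sqnorm (center S) - radius S ^+ 2) / radius S.

Definition reduced_center (R : realType) (n : nat) (S : sphere R n) (k : 'I_n)
  : R := center S k 0 / radius S.

Definition pedoe (R : realType) (n : nat) (S : sphere R n) : 'cV[R]_(2 + n) :=
  col_mx (\col_(i < 2) if i == 0 then curvature S else cocurvature S)
         (\col_(k < n) reduced_center S k).

Definition minkowski (R : realType) (n : nat) : 'M[R]_(2 + n) :=
  block_mx (\matrix_(i < 2, j < 2) if i == j then 0 else 1 / 2) 0
           0 (- 1%:M).

Definition minkowski_inv (R : realType) (n : nat) : 'M[R]_(2 + n) :=
  invmx (minkowski R n).

Lemma minkowski_invE (R : realType) (n : nat) :
  minkowski R n \in unitmx /\
  minkowski_inv R n =
    block_mx (\matrix_(i < 2, j < 2) if i == j then 0 else 2) 0 0 (- 1%:M).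
Proof.
set H := block_mx _ _ _ _.
have gH : minkowski R n *m H = 1%:M.
  rewrite mulmx_block !mulmx0 !mul0mx !addr0 !add0r mulNmx mulmxN opprK mul1mx.
  rewrite (_ : _ *m _ = 1%:M) -?scalar_mx_block //.
  apply/matrixP => i j; rewrite !mxE !big_ord_recl big_ord0 !mxE.
  case: i => [[|[|//]] ?]; case: j => [[|[|//]] ?];
    by rewrite /= ?mul0r ?mulr0 ?addr0 ?add0r ?divfK ?pnatr_eq0.
have [gu _] := mulmx1_unit gH.
by split=> //; rewrite -[H](mulKmx gu) gH mulmx1.
Qed.

Definition pedoe_mx (R : realType) (n : nat) (C : 'I_(2 + n) -> sphere R n)
  : 'M[R]_(2 + n) := \matrix_(i, j) pedoe (C j) i 0.

Definition configuration_mx (R : realType) (n : nat)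
    (C : 'I_(2 + n) -> sphere R n) : 'M[R]_(2 + n) :=
  (pedoe_mx C)^T *m minkowski R n *m pedoe_mx C.

(* The vectors b, \bar b, \dot x_1, ..., \dot x_n, in this order. *)
Definition vvec (R : realType) (n : nat) (C : 'I_(2 + n) -> sphere R n)
    (i : 'I_(2 + n)) : 'cV[R]_(2 + n) :=
  match split i with
  | inl l => if l == 0 then \col_j curvature (C j) else \col_j cocurvature (C j)
  | inr k => \col_j reduced_center (C j) k
  end.

Definition quadratic_relation (R : realType) (n : nat) (F : 'M[R]_(2 + n))
    (C : 'I_(2 + n) -> sphere R n) : Prop :=
  forall i j : 'I_(2 + n),
    ((vvec C i)^T *m F *m vvec C j) 0 0 = minkowski_inv R n i j.

(* Main.v *)
Require Import Defs.
From HB Require Import structures.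
From mathcomp Require Import all_boot all_order all_algebra.
From mathcomp Require Import reals.

Set Implicit Arguments.
Unset Strict Implicit.
Unset Printing Implicit Defensive.

Import Order.TTheory GRing.Theory Num.Theory.
Local Open Scope ring_scope.

(** The rows of [A] are the vectors [v_i], so the quadratic relation with
    matrix [F] is the single matrix equation [A F A^T = G]
    ([quadratic_relationE]).  For invertible matrices, inverting both sides
    turns it into [A^T g A = F^-1]: the relation for [F = f^-1] says exactly that
    the configuration matrix is [f] ([mulmx_tr_invP]).  This gives the first
    two claims and the equivalence for a replaced sphere.

    For uniqueness, replace the [k]-th sphere by [D] and write the Pedoe vector
    of [D] as [A x].  The configuration matrix is unchanged iff [x] has the same
    products as the basis vector [e_k], for the form [f], with itself and with
    each [e_j], [j != k].  Then [f (x - e_k)] is a multiple [t e_k], that is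
    [x = e_k + t F e_k], and equating [x^T f x] with [f_kk] leaves
    [t (2 + t F_kk) = 0].  Besides [t = 0], which is the original sphere, this
    has at most one solution ([same_products_unique]); a sphere is recovered from its
    Pedoe vector ([pedoe_inj]). *)

Section Forms.

Variables (K : fieldType) (m : nat).
Implicit Types (A f g : 'M[K]_m) (x y : 'cV[K]_m).

Lemma mulmx_tr_invP A f g : f \in unitmx -> g \in unitmx ->
  A *m invmx f *m A^T = invmx g <-> A^T *m g *m A = f.
Proof.
move=> fu gu; split=> [AFA | AgA].
- (* [A] has the right inverse [F A^T g], which is therefore a left inverse. *)
  have : A *m (invmx f *m A^T *m g) = 1%:M by rewrite !mulmxA AFA mulVmx.
  move/mulmx1C => FAgA; rewrite -[LHS](mulKVmx fu) -[RHS]mulmx1 -FAgA.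
  by rewrite !mulmxA.
- have : (invmx f *m A^T *m g) *m A = 1%:M.
    by rewrite -!mulmxA (mulmxA A^T) AgA mulVmx.
  move/mulmx1C; rewrite !mulmxA => AFAg.
  by rewrite -[LHS](mulmxK gu) AFAg mul1mx.
Qed.

(** For symmetric [f], the right-hand sides are the values of the form [f] at
    the pairs [(e_j, e_k)] and [(e_k, e_k)]. *)
Definition same_products f k x :=
  (forall j, j != k -> (f *m x) j 0 = f j k) /\ (x^T *m f *m x) 0 0 = f k k.

(** Orthogonality of [x - e_k] to every [e_j] with [j != k] confines [x] to a
    line through [e_k], on which the value at [x] of the quadratic form is a
    quadratic polynomial with the root [t = 0]. *)
Lemma same_products_line f k x : f \in unitmx -> f^T = f -> same_products f k x ->
  exists2 t, x = delta_mx k 0 + t *: col k (invmx f)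
           & t = 0 \/ t * invmx f k k = - 2.
Proof.
move=> fu fT [fx xfx]; pose t := (f *m x) k 0 - f k k.
have fxE : f *m x = col k f + t *: delta_mx k 0.
  apply/colP => j; rewrite !mxE eqxx andbT; case: eqVneq => [->|/fx].
    by rewrite mulr1 /t !mxE addrC subrK.
  by rewrite mxE mulr0 addr0.
have xE : x = delta_mx k 0 + t *: col k (invmx f).
  by rewrite -[x](mulKmx fu) fxE mulmxDr -scalemxAr !colE mulKmx.
exists t => //; move: xfx.
have -> : (x^T *m f *m x) 0 0 = (f *m x) k 0 + t * x k 0.
  have xcolE (h : 'M[K]_m) : (x^T *m col k h) 0 0 = (h^T *m x) k 0.
    by rewrite colE mulmxA -colE -[h in LHS]trmxK -trmx_mul !mxE.
  rewrite -mulmxA fxE mulmxDr -scalemxAr mxE xcolE fT -fxE.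
  by rewrite -[delta_mx k 0]mul1mx -colE [X in _ + X]mxE xcolE trmx1 mul1mx.
have -> : x k 0 = 1 + t * invmx f k k by rewrite {1}xE !mxE !eqxx.
have -> : (f *m x) k 0 = f k k + t by rewrite fxE !mxE !eqxx mulr1.
rewrite -[RHS]addr0 -addrA => /addrI/eqP.
rewrite -{1}[t]mulr1 -mulrDr addrA mulf_eq0 => /orP[/eqP ->|]; first by left.
by rewrite addrC addr_eq0 => /eqP; right.
Qed.

Lemma same_products_unique f k x y : 2 != 0 :> K -> f \in unitmx -> f^T = f ->
  same_products f k x -> same_products f k y ->
  [\/ x = delta_mx k 0, y = delta_mx k 0 | x = y].
Proof.
move=> two_neq0 fu fT /(same_products_line fu fT)[t -> [->|tF]].
  by rewrite scale0r addr0; constructor 1.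
move=> /(same_products_line fu fT)[s -> [->|sF]].
  by rewrite scale0r addr0; constructor 2.
have F_neq0 : invmx f k k != 0.
  apply: contraNneq two_neq0 => F0.
  by move/eqP: tF; rewrite F0 mulr0 eq_sym oppr_eq0.
by constructor 3; congr (_ + _ *: _); apply: (mulIf F_neq0); rewrite tF sF.
Qed.

End Forms.

Section Spheres.

Variables (R : realType) (n : nat).
Implicit Types (D : sphere R n) (C : 'I_(2 + n) -> sphere R n).

Lemma pedoe_inj : injective (@pedoe R n).
Proof.
move=> [p r r_gt0] [q s s_gt0] /eq_col_mx[/matrixP/(_ 0 0) + /matrixP pq].
rewrite !mxE /curvature /= !div1r => /invr_inj rs; subst s.
have -> : p = q.
  apply/colP => k; have := pq k 0; rewrite !mxE /reduced_center /=.
  by apply: mulIf; rewrite invr_eq0 gt_eqF.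
by congr Sphere; apply: bool_irrelevance.
Qed.

Lemma minkowski_sym : (minkowski R n)^T = minkowski R n.
Proof.
rewrite /minkowski tr_block_mx !trmx0 linearN /= trmx1; congr block_mx.
by apply/matrixP => i j; rewrite !mxE eq_sym.
Qed.

Lemma configuration_mx_sym C : (configuration_mx C)^T = configuration_mx C.
Proof. by rewrite /configuration_mx !trmx_mul trmxK minkowski_sym mulmxA. Qed.

Lemma col_pedoe_mx C j : col j (pedoe_mx C) = pedoe (C j).
Proof. by apply/colP => i; rewrite !mxE. Qed.

Lemma configuration_mxE C i j :
  configuration_mx C i j =
  ((pedoe (C i))^T *m minkowski R n *m pedoe (C j)) 0 0.
Proof.
rewrite -!col_pedoe_mx tr_col -!row_mul colE mulmxA -colE.
by rewrite [RHS]mxE [RHS]mxE.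
Qed.

Lemma vvecE C i : (vvec C i)^T = row i (pedoe_mx C).
Proof.
apply/rowP => j; rewrite /vvec mxE [RHS]mxE [RHS]mxE /pedoe -[i in RHS]splitK.
case: (split i) => [l|k] /=; last by rewrite col_mxEd !mxE.
by rewrite col_mxEu !mxE; case: (l == 0); rewrite mxE.
Qed.

Lemma quadratic_relationE (F : 'M[R]_(2 + n)) C :
  quadratic_relation F C <->
  pedoe_mx C *m F *m (pedoe_mx C)^T = minkowski_inv R n.
Proof.
have vFvE i j : ((vvec C i)^T *m F *m vvec C j) 0 0 =
    (pedoe_mx C *m F *m (pedoe_mx C)^T) i j.
  rewrite vvecE -[vvec C j]trmxK vvecE -!row_mul tr_row colE mulmxA -colE.
  by rewrite mxE mxE.
split=> [FC | FC i j]; last by rewrite vFvE FC.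
by apply/matrixP => i j; rewrite -vFvE.
Qed.

Lemma quadratic_relation_configuration (f : 'M[R]_(2 + n)) C :
  f \in unitmx -> quadratic_relation (invmx f) C <-> configuration_mx C = f.
Proof.
move=> fu; rewrite quadratic_relationE.
exact: mulmx_tr_invP fu (minkowski_invE R n).1.
Qed.

(** The Pedoe vectors of the old spheres form a basis, on which the Minkowski
    form has the configuration matrix; the last vector below is made of the
    coordinates of the new sphere on that basis. *)
Lemma replaced_same_products C k D :
  pedoe_mx C \in unitmx ->
  configuration_mx [eta C with k |-> D] = configuration_mx C ->
  same_products (configuration_mx C) k (invmx (pedoe_mx C) *m pedoe D).
Proof.
move=> Au DC; move: (_ *m pedoe D) (mulKVmx Au (pedoe D)) => x Ax.
split=> [j /negPf jk|]; rewrite -DC [RHS]configuration_mxE /= eqxx ?jk.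
  rewrite DC /configuration_mx -(mulmxA _ _ x) Ax -col_pedoe_mx tr_col -!row_mul.
  by rewrite [RHS]mxE.
by rewrite DC /configuration_mx !mulmxA -trmx_mul -(mulmxA _ _ x) Ax.
Qed.

End Spheres.

Theorem theorem5p2 (R : realType) (n : nat) (C : 'I_(2 + n) -> sphere R n)
    (C_distinct : injective C)
    (f_inv : configuration_mx C \in unitmx) :
  let A := pedoe_mx C in
  let f := configuration_mx C in
  let F := invmx f in
  [/\ A *m F *m A^T = minkowski_inv R n,
      quadratic_relation F C
    & (* the other n+1 spheres determine the k-th one by the relation *)
      forall k : 'I_(2 + n),
        (forall D : sphere R n,
           quadratic_relation F [eta C with k |-> D] <->
           configuration_mx [eta C with k |-> D] = f) /\
        (forall D D' : sphere R n,
           quadratic_relation F [eta C with k |-> D] ->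
           quadratic_relation F [eta C with k |-> D'] ->
           [\/ D = C k, D' = C k | D = D'])].
Proof.
move=> A f F.
have AF : A *m F *m A^T = minkowski_inv R n.
  exact/(mulmx_tr_invP A f_inv (minkowski_invE R n).1).
have Au : A \in unitmx.
  by move: f_inv; rewrite /configuration_mx unitmx_mul => /andP[].
split=> [||k]; [by [] | exact/quadratic_relationE |].
have relE D := quadratic_relation_configuration [eta C with k |-> D] f_inv.
split=> // D D' /relE/(replaced_same_products Au) Dx.
move=> /relE/(replaced_same_products Au) D'x.
have eqCk E : invmx A *m pedoe E = delta_mx k 0 -> E = C k.
  move=> Ek; apply: pedoe_inj.
  by rewrite -col_pedoe_mx colE -Ek mulKVmx.
have two_neq0 : 2 != 0 :> R by rewrite pnatr_eq0.
case: (same_products_unique two_neq0 f_inv (configuration_mx_sym C) Dx D'x).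
- by move/eqCk; constructor 1.
- by move/eqCk; constructor 2.
- by move/(can_inj (mulKVmx Au))/pedoe_inj; constructor 3.
Qed.
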